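(* Let $J=\{(a_\varepsilon)\in\mathbb{C}^{\mathbb{R}_+} : a_\varepsilon=0 \text{ a.e.}\}$. Then $J$ is a maximal ideal of the ring $\mathbb{C}^{\mathbb{R}_+}$; therefore ${}^*\mathbb{C}$ is a field.
   Context: $\mathbb{R}_+$ is the set of positive real numbers and $\mathbb{N}=\{1,2,3,\dots\}$. Fix an ultrafilter $\mathcal{U}$ on $\mathbb{R}_+$ such that $(0,\tfrac1n)\in\mathcal{U}$ for all $n\in\mathbb{N}$ (so $\mathcal{U}$ is free). A property $P(\varepsilon)$ of $\varepsilon\in\mathbb{R}_+$ holds almost everywhere (a.e.) if $\{\varepsilon\in\mathbb{R}_+ : P(\varepsilon)\text{ is true}\}\in\mathcal{U}$. $\mathbb{C}^{\mathbb{R}_+}$ is the commutative ring (with unity, pointwise operations) of all functions (nets) $(a_\varepsilon)$ from $\mathbb{R}_+$ to $\mathbb{C}$. Write $(a_\varepsilon)\sim(b_\varepsilon)$ if $a_\varepsilon=b_\varepsilon$ a.e., and let ${}^*\mathbb{C}=\mathbb{C}^{\mathbb{R}_+}/\!\sim$ be the corresponding factor ring (i.e. $\mathbb{C}^{\mathbb{R}_+}/J$). *)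

(* Defs.v *)
From HB Require Import structures.
From mathcomp Require Import all_boot all_order all_algebra.
From mathcomp Require Import all_classical all_reals.
From mathcomp Require Export complex.

Set Implicit Arguments.
Unset Strict Implicit.
Unset Printing Implicit Defensive.

Import Order.TTheory GRing.Theory Num.Theory.

Local Open Scope classical_set_scope.
Local Open Scope ring_scope.

(* [idealr_closed] already requires the ideal to be proper ([1 \notin I]), so
   this says: maximal, for inclusion, among the proper ideals. *)
Definition maximal_idealr_closed (A : comNzRingType) (I : {pred A}) : Prop :=
  idealr_closed I /\
  forall K : {pred A}, idealr_closed K -> {subset I <= K} -> K =i I.

(* [0 != 1] is part of [comNzRingType]. *)
Definition is_field (A : comNzRingType) : Prop :=
  forall x : A, x <> 0 -> exists y : A, x * y = 1.

Definition Rpos (R : realType) : Type := {x : R | 0 < x}.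

HB.instance Definition _ (R : realType) :=
  Choice.copy (Rpos R) {x : R | 0 < x}.

(* The library makes [T -> M] a non-zero ring only when [T] is pointed. *)
HB.instance Definition _ (R : realType) :=
  isPointed.Build (Rpos R) (exist _ 1 ltr01).

(* The ring operations are the pointwise ones; [R[i]] is the field of complex
   numbers over [R]. *)
Definition nets (R : realType) : comNzRingType := Rpos R -> R[i].

Definition ae (R : realType) (U : set_system (Rpos R))
  (P : Rpos R -> Prop) : Prop := U [set e | P e].

Definition contains_small_intervals (R : realType)
    (U : set_system (Rpos R)) : Prop :=
  forall n : nat, (0 < n)%N -> U [set e | val e < n%:R^-1].

Definition ae_eq (R : realType) (U : set_system (Rpos R))
  (a b : nets R) : Prop := ae U (fun e => a e = b e).

Definition ae_zero (R : realType) (U : set_system (Rpos R)) :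
  {pred nets R} := fun a => `[< ae U (fun e => a e = 0) >].

Lemma ae_zero_idealr_closed (R : realType) (U : set_system (Rpos R)) :
  UltraFilter U -> idealr_closed (ae_zero U).
Proof.
move=> UU; split.
- by apply/asboolP; apply: filterS filterT => e _.
- apply/asboolPn => U1; apply: (@filter_not_empty _ U).
  by apply: filterS U1 => e /= /eqP; rewrite oner_eq0.
- move=> a u v /asboolP uJ /asboolP vJ; apply/asboolP.
  apply: filterS (filterI uJ vJ) => e [/= u0 v0].
  change (a e * u e + v e = 0).
  by rewrite u0 v0 mulr0 addr0.
Qed.

Definition ae_zero_ideal (R : realType) (U : set_system (Rpos R))
    (UU : UltraFilter U) : idealr (nets R) :=
  HB.pack (ae_zero U) (isIdealr.Build _ _ (ae_zero_idealr_closed UU)).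

Definition starC (R : realType) (U : set_system (Rpos R))
  (UU : UltraFilter U) : comNzRingType := {ideal_quot (ae_zero_ideal UU)}.

(* The congruence modulo the ideal is a.e. equality: two nets have the same
   class in [starC UU] exactly when they are equal a.e. *)
Lemma starC_eqP (R : realType) (U : set_system (Rpos R))
    (UU : UltraFilter U) (a b : nets R) :
  (a = b %[mod {ideal_quot (ae_zero_ideal UU)}])%qT <-> ae_eq U a b.
Proof.
have -> : (a = b %[mod {ideal_quot (ae_zero_ideal UU)}])%qT
    <-> ae U (fun e => (a - b) e = 0).
  split=> [/eqP|ab].
    by rewrite -Quotient.idealrBE => /asboolP.
  by apply/eqP; rewrite -Quotient.idealrBE; apply/asboolP.
have subE e : (a - b) e = a e - b e by [].
split; apply: filterS => e; rewrite subE; first exact: subr0_eq.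
by move=> ->; exact: subrr.
Qed.

(* Main.v *)
Require Import Defs.
From mathcomp Require Import all_boot all_order all_algebra.
From mathcomp Require Import all_classical all_reals.

Set Implicit Arguments.
Unset Strict Implicit.

Import GRing.Theory.

Local Open Scope classical_set_scope.
Local Open Scope ring_scope.

(** A net that is not a.e. zero is a.e. nonzero because [U] is an ultrafilter,
    so its pointwise inverse is an inverse modulo the ideal of a.e. zero nets.
    An ideal that strictly contains the latter therefore contains [1], and
    every nonzero class in the quotient is invertible. *)

(* The inverse of [0] is [0], so [netV a] is defined for every net [a]. *)
Definition netV (R : realType) (a : nets R) : nets R := fun e => (a e)^-1.

Lemma netV_mul_ae (R : realType) (U : set_system (Rpos R)) (a : nets R) :
  UltraFilter U -> a \notin ae_zero U -> ae_eq U (netV a * a) 1.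
Proof.
move=> UU /asboolPn a0.
(* The ultrafilter contains either the zero set of [a], which [a0] excludes, or its complement. *)
have [//|] := in_ultra_setVsetC [set e | a e = 0] UU.
by apply: filterS => e /= /eqP; exact: mulVf.
Qed.

Lemma ae_zero_maximal (R : realType) (U : set_system (Rpos R)) :
  UltraFilter U -> maximal_idealr_closed (ae_zero U).
Proof.
move=> UU; split; first exact: ae_zero_idealr_closed.
move=> K [K0 K1 Kl] JK a; apply/idP/idP; last exact: JK.
apply: contraLR => aJ; apply: contra K1 => aK.
(* [Kl] gives closure under [c * u + v]: here [u] is [a], in [K] by [aK], and [v] is
   [1 - netV a * a], which is a.e. zero and so in [K] by [JK]. *)
have -> : 1 = netV a * a + (1 - netV a * a) by rewrite addrC subrK.
apply: Kl => //; apply: JK; apply/asboolP.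
apply: filterS (netV_mul_ae UU aJ) => e /= ae1.
change (1 - (netV a * a) e = 0).
by rewrite ae1; exact: subrr.
Qed.

Lemma starC_is_field (R : realType) (U : set_system (Rpos R))
  (UU : UltraFilter U) : is_field (starC UU).
Proof.
move=> x x0; pose a : nets R := repr (x : {ideal_quot (ae_zero_ideal UU)}).
have xE : x = \pi_{ideal_quot (ae_zero_ideal UU)}%qT a by rewrite reprK.
have aJ : a \notin ae_zero U.
  apply/asboolPn => a0; apply: x0; rewrite xE.
  transitivity (\pi_{ideal_quot (ae_zero_ideal UU)}%qT (0 : nets R)).
    exact/starC_eqP.
  exact: rmorph0.
exists (\pi_{ideal_quot (ae_zero_ideal UU)}%qT (netV a)).
(* Both sides become classes of nets, [netV a * a] and [1], so that a.e. equality suffices. *)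
rewrite mulrC xE -[LHS]rmorphM -[RHS](rmorph1 \pi_{ideal_quot (ae_zero_ideal UU)}%qT).
by apply/starC_eqP; exact: netV_mul_ae.
Qed.

Theorem theorem2p3p3 (R : realType) (U : set_system (Rpos R))
    (UU : UltraFilter U) (Usmall : contains_small_intervals U) :
  maximal_idealr_closed (ae_zero U) /\ is_field (starC UU).
Proof. by split; [exact: ae_zero_maximal | exact: starC_is_field]. Qed.
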